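(* Let ${\cal O}$ be the union of some of the sets $A^mB^n$, including $A$ and $B$. Then, the set $Q^{\cal O}$ of ${\cal O}$-positive distributions is closed under wirings.
   Context: Bipartite Bell scenario: Alice (Bob) feeds an input $x$ ($y$) from a finite alphabet and receives an output $a$ ($b$) from a finite alphabet; a box is a no-signalling distribution $P(a,b|x,y)$. Assign symbolic projectors $E^x_a$ (Alice) and $F^y_b$ (Bob) to each local event $(x,a)$, $(y,b)$; $A$ and $B$ denote the sets of Alice's and Bob's projectors. They can be conjugated and multiplied formally, every $F$ commutes with every $E$, and a product of two consecutive projectors corresponding to different outcomes of the same measurement equals 0. $A^mB^n$ denotes the set of all products $E^{x_1}_{a_1}\cdots E^{x_{m'}}_{a_{m'}}F^{y_1}_{b_1}\cdots F^{y_{n'}}_{b_{n'}}$ with $m'\leq m$, $n'\leq n$ (taking $m'=n'=0$ gives the identity $1$). ${\cal O}$ is a (symmetric) union of sets of this type containing $A$ and $B$; $\overline{{\cal O}}$ is the real span of ${\cal O}$ and $\overline{{\cal O}}^2$ the real span of products of two elements of ${\cal O}$. A no-signalling distribution $P(a,b|x,y)$ is ${\cal O}$-positive if there exists a linear functional $L:\overline{{\cal O}}^2\to\mathbb{R}$ with $L(1)=1$, $L(ff^\dagger)\geq 0$ for all $f\in\overline{{\cal O}}$, and $P(a,b|x,y)=L(E^x_aF^y_b)$. A set of boxes is closed under wirings if, for any finite collection of boxes from the set and any pair of local wirings (each party sequentially chooses which of its local boxes to probe and with which input as a function of its effective input and previously obtained outputs, and then post-processes the obtained outputs into an effective output), the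 resulting effective box belongs to the set. *)

(* Defs.v *)
From HB Require Import structures.
From mathcomp Require Import all_boot all_order all_algebra.
From mathcomp Require Import reals.
Set Implicit Arguments. Unset Strict Implicit. Unset Printing Implicit Defensive.
Import Order.TTheory GRing.Theory Num.Theory.
Local Open Scope ring_scope.

Section Bell.
Variable R : realType.

(* Boxes in the Bell scenario with input alphabets X (Alice), Y (Bob)  *)
(* and output alphabets A (Alice), B (Bob).  P x y a b = P(a,b|x,y).   *)
Section Box.
Variables (X A Y B : finType).

Definition is_box (P : X -> Y -> A -> B -> R) : Prop :=
  [/\ (0 < #|X|)%N, (0 < #|Y|)%N & (forall x y a b, 0 <= P x y a b)] /\
  [/\
      (forall x y, \sum_(a : A) \sum_(b : B) P x y a b = 1),
      (forall x y y' a, \sum_(b : B) P x y a b = \sum_(b : B) P x y' a b) &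
      (forall x x' y b, \sum_(a : A) P x y a b = \sum_(a : A) P x' y a b)].

(* marginals (well defined by no-signalling; averaged over the other input) *)
Definition margA (P : X -> Y -> A -> B -> R) (x : X) (a : A) : R :=
  (#|Y|%:R)^-1 * \sum_(y : Y) \sum_(b : B) P x y a b.
Definition margB (P : X -> Y -> A -> B -> R) (y : Y) (b : B) : R :=
  (#|X|%:R)^-1 * \sum_(x : X) \sum_(a : A) P x y a b.

(* Symbolic projectors: letter inl (x,a) is E^x_a, inr (y,b) is F^y_b. *)
(* Monomials are words; elements of the free real algebra are formal   *)
(* finite linear combinations of words.                                *)
Definition letter : Type := ((X * A) + (Y * B))%type.
Definition word : Type := seq letter.
Definition fsum : Type := seq (R * word).

Definition coef (p : fsum) (w : word) : R := \sum_(t <- p | t.2 == w) t.1.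

Definition is_relator (r : fsum) : Prop :=
  (exists (e : X * A) (f : Y * B),
      r = [:: (1, [:: inl e; inr f]); (-1, [:: inr f; inl e])]) \/
  (exists l : letter, r = [:: (1, [:: l; l]); (-1, [:: l])]) \/
  (exists (x : X) (a a' : A), a != a' /\ r = [:: (1, [:: inl (x, a); inl (x, a')])]) \/
  (exists (y : Y) (b b' : B), b != b' /\ r = [:: (1, [:: inr (y, b); inr (y, b')])]).

(* the element  sum_i c_i u_i r_i v_i  of the two-sided ideal *)
Definition ideal_sum (ts : seq (R * word * fsum * word)) : fsum :=
  flatten [seq [seq (t.1.1.1 * d.1, t.1.1.2 ++ d.2 ++ t.2) | d <- t.1.2] | t <- ts].

Definition in_ideal (p : fsum) : Prop :=
  exists ts : seq (R * word * fsum * word),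
    (forall t, t \in ts -> is_relator t.1.2) /\
    (forall w, coef p w = coef (ideal_sum ts) w).

(* the conjugate of a word (projectors are self-adjoint) *)
Definition conjw (w : word) : word := rev w.

Definition in_AmBn (m n : nat) (w : word) : Prop :=
  exists (u : seq (X * A)) (v : seq (Y * B)),
    [/\ (size u <= m)%N, (size v <= n)%N & w = map inl u ++ map inr v].

Definition in_O (Ob : nat -> nat -> Prop) (w : word) : Prop :=
  exists m n, Ob m n /\ in_AmBn m n w.

(* words spanning \bar O^2 = span { o o'^dagger : o, o' in O }
   (= span { o o' } because O is symmetric) *)
Definition in_O2 (Ob : nat -> nat -> Prop) (w : word) : Prop :=
  exists u v, [/\ in_O Ob u, in_O Ob v & w = u ++ conjw v].

Definition evalL (L : word -> R) (p : fsum) : R := \sum_(t <- p) t.1 * L t.2.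

(* O-positivity: there is a linear functional L on \bar O^2 (an element
   of the quotient algebra), i.e. a function on the spanning words of
   \bar O^2 vanishing on every element of the ideal supported on them,
   with L(1) = 1, L(f f^dagger) >= 0 for f in \bar O and
   P(a,b|x,y) = L(E^x_a F^y_b). *)
Definition O_positive (Ob : nat -> nat -> Prop) (P : X -> Y -> A -> B -> R) : Prop :=
  is_box P /\
  exists L : word -> R,
    [/\ (forall p : fsum, in_ideal p ->
            (forall w, coef p w != 0 -> in_O2 Ob w) -> evalL L p = 0),
        L [::] = 1,
        (forall f : seq (R * word), (forall t, t \in f -> in_O Ob t.2) ->
            0 <= \sum_(s <- f) \sum_(t <- f) s.1 * t.1 * L (s.2 ++ conjw t.2)) &
        (forall x y a b, P x y a b = L [:: inl (x, a); inr (y, b)])].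

End Box.

(* A collection of K boxes; box k has alphabets X k, A k (Alice) and   *)
(* Y k, B k (Bob).  A local wiring of one party, for a fixed effective *)
(* input, is a finite decision tree: at each node it probes a box k    *)
(* with an input (depending on previously obtained outputs); at the    *)
(* leaves it outputs the effective output.                             *)
Section Wiring.
Variable K : nat.

Inductive strat (I O : 'I_K -> finType) (Out : Type) : Type :=
| Leaf of Out
| Probe (k : 'I_K) of I k & (O k -> strat I O Out).

Arguments Leaf {I O Out}.
Arguments Probe {I O Out}.

Fixpoint once_from {I O : 'I_K -> finType} {Out : Type}
    (t : strat I O Out) (used : seq 'I_K) : Prop :=
  match t with
  | Leaf _ => True
  | Probe k _ c => k \notin used /\ forall o, once_from (c o) (k :: used)
  end.
Definition once {I O : 'I_K -> finType} {Out : Type} (t : strat I O Out) :=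
  once_from t [::].

Fixpoint result {I O : 'I_K -> finType} {Out : Type}
    (t : strat I O Out) (o : forall k, O k) : Out :=
  match t with
  | Leaf r => r
  | Probe k _ c => result (c (o k)) o
  end.

Fixpoint input {I O : 'I_K -> finType} {Out : Type}
    (t : strat I O Out) (o : forall k, O k) (k : 'I_K) : option (I k) :=
  match t with
  | Leaf _ => None
  | Probe k' i c =>
      if k' =P k is ReflectT e then Some (eq_rect k' (fun j => (I j : Type)) i k e)
      else input (c (o k')) o k
  end.

Variables (X A Y B : 'I_K -> finType).
Variable (P : forall k, X k -> Y k -> A k -> B k -> R).

(* weight of the joint output assignment (a, b) of all boxes; outputs of
   boxes that a party does not probe are irrelevant and are filled in
   uniformly at random (this does not affect the effective box) *)
Definition box_weight (k : 'I_K) (ik : option (X k)) (jk : option (Y k))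
    (a : A k) (b : B k) : R :=
  match ik, jk with
  | Some x, Some y => @P k x y a b
  | Some x, None => margA (@P k) x a / #|B k|%:R
  | None, Some y => margB (@P k) y b / #|A k|%:R
  | None, None => (#|A k|%:R * #|B k|%:R)^-1
  end.

Variables (X' A' Y' B' : finType).

Definition wired (TA : X' -> strat X A A') (TB : Y' -> strat Y B B')
    (x' : X') (y' : Y') (a' : A') (b' : B') : R :=
  \sum_(a : {dffun forall k, A k}) \sum_(b : {dffun forall k, B k})
    if (result (TA x') a == a') && (result (TB y') b == b') then
      \prod_(k : 'I_K) box_weight (input (TA x') a k) (input (TB y') b k) (a k) (b k)
    else 0.

End Wiring.

Arguments Leaf {K I O Out}.
Arguments Probe {K I O Out}.

Definition closed_under_wirings
    (S : forall X A Y B : finType, (X -> Y -> A -> B -> R) -> Prop) : Prop :=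
  forall (K : nat) (X A Y B : 'I_K -> finType)
         (P : forall k, X k -> Y k -> A k -> B k -> R),
    (forall k, S (X k) (A k) (Y k) (B k) (P k)) ->
    forall (X' A' Y' B' : finType), (0 < #|X'|)%N -> (0 < #|Y'|)%N ->
    forall (TA : X' -> strat X A A') (TB : Y' -> strat Y B B'),
      (forall x', once (TA x')) -> (forall y', once (TB y')) ->
      S X' A' Y' B' (wired P TA TB).

End Bell.

(* Main.v *)
Require Import Defs.
From HB Require Import structures.
From mathcomp Require Import all_boot all_order all_algebra.
From mathcomp Require Import boolp reals ring lra.
Set Implicit Arguments. Unset Strict Implicit. Unset Printing Implicit Defensive.
Import Order.TTheory GRing.Theory Num.Theory.
Local Open Scope ring_scope.

(* An O-positive functional extends to the whole word algebra modulo the ideal and,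
   after symmetrisation, becomes a function M(u, v) of a word u in Alice's projectors
   and a word v in Bob's.  Assign to each effective event of a wiring the sum, over the
   leaves of the decision tree that produce it, of the tensor products of the projectors
   met on the way.  Since no box is probed twice along a branch, these sums satisfy the
   projector relations, and a product of m of them only involves products of at most m
   projectors of each box.  The tensor product of the functionals of the boxes therefore
   induces a functional for the wired box, and it is positive by the Schur product
   theorem. *)

(** * Positive semidefinite kernels *)

Section Psd.
Variable R : rcfType.

Definition quad (I : finType) (G : I -> I -> R) (c : I -> R) : R :=
  \sum_i c i * \sum_j c j * G i j.

Definition psd (I : finType) (G : I -> I -> R) : Prop := forall c, 0 <= quad G c.

Lemma sum_shift (I : finType) (f h : I -> R) i0 l :
  \sum_i (f i + l * (i == i0)%:R) * h i = \sum_i f i * h i + l * h i0.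
Proof.
under eq_bigr do rewrite mulrDl.
rewrite big_split /= [X in _ + X](bigD1 i0) //= eqxx mulr1.
by rewrite [X in _ + (_ + X)]big1 ?addr0 // => i /negbTE->; rewrite mulr0 mul0r.
Qed.

Lemma quad_shift (I : finType) (G : I -> I -> R) c i0 l :
  (forall i j, G i j = G j i) ->
  quad G (fun i => c i + l * (i == i0)%:R) =
  quad G c + 2 * l * (\sum_i c i * G i i0) + l ^+ 2 * G i0 i0.
Proof.
move=> symG; rewrite /quad sum_shift sum_shift.
under eq_bigr do rewrite sum_shift mulrDr.
rewrite big_split /=.
have -> : \sum_i c i * (l * G i i0) = l * \sum_i c i * G i i0.
  by rewrite mulr_sumr; apply: eq_bigr => i _; rewrite mulrCA.
have -> : \sum_i c i * G i0 i = \sum_i c i * G i i0.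
  by apply: eq_bigr => i _; rewrite symG.
ring.
Qed.

(** The quadratic is tested at its minimum [- b / e] when [0 < e], and at [- b] otherwise; there it
    is negative unless [b = 0]. *)
Lemma linear_ge0_eq0 (b e : R) : (forall l, 0 <= 2 * l * b + l ^+ 2 * e) -> b = 0.
Proof.
move=> H.
have [e0|e0] := lerP e 0.
  have := H (- b); have : 0 <= b ^+ 2 by exact: sqr_ge0.
  by move=> h1 h2; apply/eqP; rewrite -sqrf_eq0; apply/eqP; nra.
have := H (- (b / e)); have -> : 2 * - (b / e) * b + (- (b / e)) ^+ 2 * e = - (b ^+ 2 / e).
  by field; rewrite gt_eqF.
rewrite oppr_ge0 pmulr_lle0 ?invr_gt0 // => h.
by apply/eqP; rewrite -sqrf_eq0 eq_le h sqr_ge0.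
Qed.

(** Moving a null vector along one coordinate gives a nonnegative quadratic in the step without
    constant term, so its linear coefficient vanishes. *)
Lemma psd_null (I : finType) (G : I -> I -> R) c i0 :
  (forall i j, G i j = G j i) -> psd G -> quad G c = 0 ->
  \sum_i c i * G i i0 = 0.
Proof.
move=> symG pG c0; apply: (@linear_ge0_eq0 _ (G i0 i0)) => l.
by have := pG (fun i => c i + l * (i == i0)%:R); rewrite quad_shift // c0 add0r.
Qed.

Lemma quad_delta (I : finType) (G : I -> I -> R) i0 :
  quad G (fun i => (i == i0)%:R) = G i0 i0.
Proof.
have E (h : I -> R) : \sum_i (i == i0)%:R * h i = h i0.
  rewrite (bigD1 i0) //= eqxx mul1r big1 ?addr0 // => i /negbTE->.
  by rewrite mul0r.
by rewrite /quad E E.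
Qed.

(* Repeatedly taking Schur complements at a nonzero diagonal entry. *)
Lemma psd_gram (I : finType) (G : I -> I -> R) :
  (forall i j, G i j = G j i) -> psd G ->
  exists W : seq (I -> R), forall i j, G i j = \sum_(w <- W) w i * w j.
Proof.
have [n] := ubnP #|[set i | G i i != 0]|.
elim: n G => // n IHn G; rewrite ltnS => leGn symG pG.
have dge0 i : 0 <= G i i by rewrite -quad_delta.
have row0 i : G i i = 0 -> forall j, G j i = 0.
  move=> Gi0 j; have q0 : quad G (fun k => (k == i)%:R) = 0 by rewrite quad_delta.
  have := psd_null j symG pG q0.
  rewrite (bigD1 i) //= eqxx mul1r big1 ?addr0 1?symG // => k /negbTE->.
  by rewrite mul0r.
have [/existsP[i0 d0]|] := boolP [exists i, G i i != 0]; last first.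
  rewrite negb_exists => /forallP d0; exists [::] => i j.
  by rewrite big_nil; apply: row0; apply/eqP; have := d0 j; rewrite negbK.
set d := G i0 i0; have dgt0 : 0 < d by rewrite lt_neqAle eq_sym d0 dge0.
pose G' i j := G i j - G i i0 * G j i0 / d.
have symG' i j : G' i j = G' j i by rewrite /G' symG [G i i0 * _]mulrC.
have pG' : psd G'.
  move=> c; set b := \sum_i c i * G i i0.
  have -> : quad G' c = quad G c - b ^+ 2 / d.
    rewrite /quad /G'.
    have E i : \sum_j c j * (G i j - G i i0 * G j i0 / d) =
        \sum_j c j * G i j - G i i0 * (b / d).
      rewrite /b mulr_suml mulr_sumr -sumrB; apply: eq_bigr => j _; ring.
    under eq_bigr do rewrite E mulrBr [c _ * (_ * _)]mulrA.
    by rewrite sumrB -[X in _ - X]mulr_suml -/b; ring.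
  (* Shifting coordinate [i0] by [- b / d] minimises the form of [G]; the minimum is the form of the
     Schur complement [G']. *)
  have := pG (fun i => c i + (- b / d) * (i == i0)%:R).
  rewrite quad_shift // -/b -/d.
  set q := quad G c; suff -> : q + 2 * (- b / d) * b + (- b / d) ^+ 2 * d = q - b ^+ 2 / d by [].
  by field; rewrite gt_eqF.
(* The number of nonzero diagonal entries drops: a zero entry stays zero because its whole row is
   zero, and the entry at [i0] becomes zero. *)
have [|W HW] := IHn G' _ symG' pG'.
  apply: leq_trans leGn; apply: proper_card; apply/properP; split.
    apply/subsetP=> i; rewrite !inE; apply: contra => /eqP Gi0.
    by rewrite /G' Gi0 symG (row0 _ Gi0) mul0r mul0r subrr.
  by exists i0; rewrite !inE // /G' -/d (mulfK d0) subrr eqxx.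
exists ((fun i => G i i0 / Num.sqrt d) :: W) => i j.
rewrite big_cons -HW /G'.
have -> : G i i0 / Num.sqrt d * (G j i0 / Num.sqrt d) = G i i0 * G j i0 / (Num.sqrt d ^+ 2).
  by field; rewrite sqrtr_eq0 -ltNge.
by rewrite sqr_sqrtr ?ltW //; ring.
Qed.

(** Writing [G] as a Gram sum over [w] turns the form of the entrywise product at [c] into a sum of
    forms of [H] at the vectors [c i * w i]. *)
Lemma psd_mul (I : finType) (G H : I -> I -> R) :
  (forall i j, G i j = G j i) -> psd G -> psd H -> psd (fun i j => G i j * H i j).
Proof.
move=> symG pG pH c; have [W HW] := psd_gram symG pG.
suff -> : quad (fun i j => G i j * H i j) c =
    \sum_(w <- W) quad H (fun i => c i * w i) by apply: sumr_ge0.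
rewrite /quad exchange_big /=; apply: eq_bigr => i _.
under [RHS]eq_bigr do rewrite mulr_sumr.
rewrite exchange_big /= mulr_sumr; apply: eq_bigr => j _.
rewrite HW mulr_suml !mulr_sumr; apply: eq_bigr => w _; ring.
Qed.

Lemma psd_prod (I J : finType) (G : J -> I -> I -> R) :
  (forall k i j, G k i j = G k j i) -> (forall k, psd (G k)) ->
  psd (fun i j => \prod_k G k i j).
Proof.
move=> symG pG c.
have: (forall i j, \prod_k G k i j = \prod_k G k j i) /\ psd (fun i j => \prod_k G k i j).
  elim: (index_enum J) => [|k r [symr pr]].
    split=> [i j|{}c]; first by rewrite !big_nil.
    rewrite /quad; under eq_bigr do under eq_bigr do rewrite big_nil mulr1.
    by rewrite -mulr_suml -expr2 sqr_ge0.
  split=> [i j|{}c]; first by rewrite !big_cons symG symr.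
  have := psd_mul (symG k) (pG k) pr c.
  congr (_ <= _); apply: eq_bigr => i _; congr (_ * _); apply: eq_bigr => j _.
  by rewrite big_cons.
by case.
Qed.

(** [T] may be infinite, so positivity is tested on finite families of points of [D], repetitions
    allowed. *)
Definition psd_on (T : Type) (D : T -> Prop) (G : T -> T -> R) : Prop :=
  forall (I : finType) (e : I -> T), (forall i, D (e i)) -> psd (fun i j => G (e i) (e j)).

Lemma psd_onP (T : eqType) (D : T -> Prop) (G : T -> T -> R) :
  psd_on D G <->
  forall f : seq (R * T), (forall t, t \in f -> D t.2) ->
    0 <= \sum_(s <- f) \sum_(t <- f) s.1 * t.1 * G s.2 t.2.
Proof.
split=> [pG f Df|pG I e De c].
  have := pG _ (fun i : 'I_(size f) => (tnth (in_tuple f) i).2).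
  move=> /(_ (fun i => Df _ (mem_tnth i (in_tuple f)))) /(_ (fun i => (tnth (in_tuple f) i).1)).
  move/le_trans; apply; rewrite le_eqVlt; apply/orP; left; apply/eqP.
  rewrite [RHS]big_tnth; apply: eq_bigr => i _.
  by rewrite [RHS]big_tnth mulr_sumr; apply: eq_bigr => j _; rewrite mulrA.
have := pG [seq (c i, e i) | i <- index_enum I].
rewrite big_map /quad => /(_ _)/le_trans -> //; first by move=> t /mapP[i _ ->] /=.
rewrite le_eqVlt; apply/orP; left; apply/eqP; apply: eq_bigr => i _.
by rewrite big_map mulr_sumr; apply: eq_bigr => j _; rewrite mulrA.
Qed.

End Psd.

(** * O-positivity in terms of pairs of words *)

(** The relations of one party, imposed inside arbitrary words: [m] descends to the quotient by the
    ideal they generate. *)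
Definition projective (R : realType) (I O : eqType) (m : seq (I * O) -> R) : Prop :=
  (forall u l v, m (u ++ [:: l; l] ++ v) = m (u ++ [:: l] ++ v)) /\
  (forall u x a a' v, a != a' -> m (u ++ [:: (x, a); (x, a')] ++ v) = 0).

Definition sizes_in (Ob : nat -> nat -> Prop) (S T : Type) (p : seq S * seq T) : Prop :=
  exists m n, [/\ Ob m n, (size p.1 <= m)%N & (size p.2 <= n)%N].

Definition moment_kernel (R : realType) (S T : Type) (M : seq S -> seq T -> R)
    (p q : seq S * seq T) : R :=
  M (p.1 ++ rev q.1) (p.2 ++ rev q.2).

(** [M u v] is the value at the product of Alice's word [u] and Bob's word [v], so commutation of
    the parties is built into the encoding. [M] is total on words, but positivity is asked only on
    pairs from [O]. Invariance under reversal makes the kernel symmetric. *)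
Definition moment_functional (R : realType) (Ob : nat -> nat -> Prop)
    (X A Y B : eqType) (M : seq (X * A) -> seq (Y * B) -> R) : Prop :=
  [/\ forall v, projective (M^~ v), forall u, projective (M u),
      forall u v, M (rev u) (rev v) = M u v, M [::] [::] = 1 &
      psd_on (@sizes_in Ob _ _) (moment_kernel M)].

Section MomentTheory.
Variables (R : realType) (Ob : nat -> nat -> Prop).
Hypotheses (Ob10 : Ob 1%N 0%N) (Ob01 : Ob 0%N 1%N).

Lemma moment_kernel_sym (S T : Type) (M : seq S -> seq T -> R) p q :
  (forall u v, M (rev u) (rev v) = M u v) ->
  moment_kernel M p q = moment_kernel M q p.
Proof. by move=> symM; rewrite /moment_kernel -symM !rev_cat !revK. Qed.

(** * Completeness of the measurements of one box *)

Section Completeness.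
Variables (X A Y B : finType) (M : seq (X * A) -> seq (Y * B) -> R).
Hypothesis (momM : moment_functional Ob M).
Variables (x : X) (y : Y).
Hypothesis norm1 : \sum_a \sum_b M [:: (x, a)] [:: (y, b)] = 1.

(** The kernel is restricted to [1], the [E^x_a] and the [F^y_b] for one pair of inputs; [cst p q t]
    is then the vector of [p + q sum_a E^x_a + t sum_b F^y_b]. *)
Let el (i : unit + (A + B)) : seq (X * A) * seq (Y * B) :=
  match i with
  | inl _ => ([::], [::])
  | inr (inl a) => ([:: (x, a)], [::])
  | inr (inr b) => ([::], [:: (y, b)])
  end.
Let G i j := moment_kernel M (el i) (el j).
Let cst (p q t : R) (i : unit + (A + B)) : R :=
  match i with inl _ => p | inr (inl _) => q | inr (inr _) => t end.
Let alpha := \sum_a M [:: (x, a)] [::].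
Let beta := \sum_b M [::] [:: (y, b)].

Let symM u v : M (rev u) (rev v) = M u v. Proof. by case: momM. Qed.

Let symG i j : G i j = G j i. Proof. exact: moment_kernel_sym. Qed.

Let psdG : psd G.
Proof.
have [_ _ _ _ pM] := momM; apply: pM => -[u|[a|b]].
- by exists 1%N, 0%N.
- by exists 1%N, 0%N.
- by exists 0%N, 1%N.
Qed.

Let sum_cst p q t h : \sum_i cst p q t i * h i =
  p * h (inl tt) + q * \sum_a h (inr (inl a)) + t * \sum_b h (inr (inr b)).
Proof.
rewrite big_sumType /= big_sumType /= (bigD1 tt) //= big1 ?addr0; last by case.
by rewrite !mulr_sumr addrA.
Qed.

Let diagA a : \sum_a' M [:: (x, a'); (x, a)] [::] = M [:: (x, a)] [::].
Proof.
have [/(_ [::])[idem orth] _ _ _ _] := momM.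
rewrite (bigD1 a) //= big1 ?addr0; first exact: (idem [::] _ [::]).
by move=> a' ne; apply: (orth [::] x a' a [::]).
Qed.

Let diagB b : \sum_b' M [::] [:: (y, b'); (y, b)] = M [::] [:: (y, b)].
Proof.
have [_ /(_ [::])[idem orth] _ _ _] := momM.
rewrite (bigD1 b) //= big1 ?addr0; first exact: (idem [::] _ [::]).
by move=> b' ne; apply: (orth [::] y b' b [::]).
Qed.

Let row p q t i : \sum_j cst p q t j * G j i =
  match i with
  | inl _ => p + q * alpha + t * beta
  | inr (inl a) => p * M [:: (x, a)] [::] + q * M [:: (x, a)] [::]
                   + t * \sum_b M [:: (x, a)] [:: (y, b)]
  | inr (inr b) => p * M [::] [:: (y, b)] + q * (\sum_a M [:: (x, a)] [:: (y, b)])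
                   + t * M [::] [:: (y, b)]
  end.
Proof.
have [_ _ _ M1 _] := momM.
by rewrite sum_cst /G /moment_kernel; case: i => [u|[a|b]] /=;
  rewrite ?M1 ?mulr1 ?diagA ?diagB.
Qed.

Let quad_cst p q t : quad G (cst p q t) =
  p * (p + q * alpha + t * beta) + q * (p * alpha + q * alpha + t)
  + t * (p * beta + q + t * beta).
Proof.
rewrite /quad; under eq_bigr do under eq_bigr do rewrite symG.
under eq_bigr do rewrite row.
rewrite sum_cst !big_split -!mulr_sumr /= -/alpha -/beta norm1 exchange_big /=.
by rewrite norm1 !mulr1.
Qed.

(* The relations do not include sum_a E^x_a = 1.  Normalisation of the box makes
   1 - sum_a E^x_a and 1 - sum_b F^y_b null vectors of the kernel, which suffices. *)
Let alpha_beta1 : alpha = 1 /\ beta = 1.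
Proof.
(* In this order, the three forms are [1 - alpha], [1 - beta] and [alpha + beta - 2]. *)
have := psdG (cst 1 (-1) 0); have := psdG (cst 1 0 (-1)); have := psdG (cst 0 1 (-1)).
rewrite !quad_cst => h1 h2 h3; split; lra.
Qed.

(** For a single letter, [psd_null] pairs the null vector [1 - sum_a E^x_a] with the row of [F^y_b];
    for the empty word the claim is [alpha = 1]. *)
Lemma sum_outcomesA (v : seq (Y * B)) : v = [::] \/ (exists b, v = [:: (y, b)]) ->
  \sum_a M [:: (x, a)] v = M [::] v.
Proof.
have [a1 b1] := alpha_beta1; have [_ _ _ M1 _] := momM.
move=> [->|[b ->]]; first by rewrite M1.
have /(psd_null (inr (inr b)) symG psdG) : quad G (cst 1 (-1) 0) = 0.
  by rewrite quad_cst a1 b1; ring.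
by rewrite row mul0r => h; lra.
Qed.

Lemma sum_outcomesB (u : seq (X * A)) : u = [::] \/ (exists a, u = [:: (x, a)]) ->
  \sum_b M u [:: (y, b)] = M u [::].
Proof.
have [a1 b1] := alpha_beta1; have [_ _ _ M1 _] := momM.
move=> [->|[a ->]]; first by rewrite M1.
have /(psd_null (inr (inl a)) symG psdG) : quad G (cst 1 0 (-1)) = 0.
  by rewrite quad_cst a1 b1; ring.
by rewrite row mul0r => h; lra.
Qed.

End Completeness.

(** * The quotient algebra, and the passage between functionals and moment functionals *)

Section Box.
Variables (X A Y B : finType).
Implicit Types (w p q : word X A Y B) (f g : fsum R X A Y B) (L : word X A Y B -> R).

Lemma coef_cat f g w : coef (f ++ g) w = coef f w + coef g w.
Proof. by rewrite /coef big_cat. Qed.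

Lemma evalL_coef L f r : uniq r -> {subset unzip2 f <= r} ->
  evalL L f = \sum_(w <- r) coef f w * L w.
Proof.
move=> uniq_r sub; rewrite /evalL /coef.
under [RHS]eq_bigr do rewrite mulr_suml.
rewrite (exchange_big_dep predT) //= big_seq [RHS]big_seq; apply: eq_bigr => t tf.
rewrite -big_filter (_ : [seq w <- r | t.2 == w] = [:: t.2]) ?big_seq1 //.
rewrite -(filter_pred1_uniq uniq_r (sub _ (map_f _ tf))).
by apply: eq_filter => w; rewrite /= eq_sym.
Qed.

(** An element of the free algebra has many presentations as a list; evaluation sees only the
    coefficients, as both sums can be taken over a common duplicate-free list of words. *)
Lemma eq_evalL L f g : coef f =1 coef g -> evalL L f = evalL L g.
Proof.
move=> E; pose r := undup (unzip2 f ++ unzip2 g).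
rewrite (@evalL_coef L f r) ?undup_uniq ?(@evalL_coef L g r) ?undup_uniq //.
- by apply: eq_bigr => w _; rewrite E.
- by move=> w wg; rewrite mem_undup mem_cat wg orbT.
- by move=> w wf; rewrite mem_undup mem_cat wf.
Qed.

Lemma in_ideal_coef f g : coef f =1 coef g -> in_ideal f -> in_ideal g.
Proof. by move=> E [ts [rel ts_f]]; exists ts; split=> // w; rewrite -E. Qed.

Lemma in_ideal_cat f g : in_ideal f -> in_ideal g -> in_ideal (f ++ g).
Proof.
move=> [ts [rel Ef]] [ts' [rel' Eg]]; exists (ts ++ ts'); split.
  by move=> t; rewrite mem_cat => /orP[/rel|/rel'].
by move=> w; rewrite coef_cat Ef Eg /ideal_sum map_cat flatten_cat coef_cat.
Qed.

Lemma in_ideal_relator p q (r : fsum R X A Y B) (c : R) : is_relator r ->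
  in_ideal [seq (c * d.1, p ++ d.2 ++ q) | d <- r].
Proof.
move=> rel; exists [:: (c, p, r, q)]; split=> [t|w]; first by rewrite inE => /eqP->.
by rewrite /ideal_sum /= cats0.
Qed.

(** Equality of words in the quotient algebra. *)
Definition weq (w w' : word X A Y B) : Prop :=
  in_ideal ([:: (1, w); (-1, w')] : fsum R X A Y B).

Lemma coef_pair (c d : R) w1 w2 w :
  coef [:: (c, w1); (d, w2)] w = c * (w1 == w)%:R + d * (w2 == w)%:R.
Proof.
rewrite /coef !big_cons big_nil /=.
by case: (w1 == w); case: (w2 == w); rewrite ?mulr0 ?mulr1 ?addr0 ?add0r.
Qed.

Lemma coef1 (c : R) w1 w : coef [:: (c, w1)] w = c * (w1 == w)%:R.
Proof. by rewrite /coef big_cons big_nil /=; case: (w1 == w); rewrite ?mulr0 ?mulr1 ?addr0. Qed.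

Lemma weq_refl w : weq w w.
Proof.
exists [::]; split=> // w'; rewrite coef_pair /coef big_nil; ring.
Qed.

Lemma weq_trans w1 w2 w3 : weq w1 w2 -> weq w2 w3 -> weq w1 w3.
Proof.
move=> h1 h2; apply: in_ideal_coef (in_ideal_cat h1 h2) => w.
rewrite coef_cat !coef_pair; ring.
Qed.

Lemma in_ideal_opp f : in_ideal f -> in_ideal [seq (- t.1, t.2) | t <- f].
Proof.
move=> [ts [rel E]]; exists [seq (- t.1.1.1, t.1.1.2, t.1.2, t.2) | t <- ts]; split.
  by move=> _ /mapP[t /rel ? ->].
have coefN g w : coef [seq (- t.1, t.2) | t <- g] w = - coef g w.
  by rewrite /coef big_map -sumrN.
move=> w; rewrite coefN E -coefN /ideal_sum; congr (coef _ w).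
rewrite map_flatten -!map_comp; congr flatten; apply: eq_map => t /=.
by rewrite -map_comp; apply: eq_map => d /=; rewrite mulNr.
Qed.

Lemma weq_sym w1 w2 : weq w1 w2 -> weq w2 w1.
Proof.
move=> /in_ideal_opp; apply: in_ideal_coef => w.
rewrite /= !coef_pair; ring.
Qed.

Lemma weq_zero w1 w2 : weq w1 w2 -> in_ideal ([:: (1, w1)] : fsum R X A Y B) ->
  in_ideal ([:: (1, w2)] : fsum R X A Y B).
Proof.
move=> /weq_sym h1 h2; apply: in_ideal_coef (in_ideal_cat h1 h2) => w.
rewrite coef_cat !coef_pair !coef1; ring.
Qed.

(** For a functional given on all words, this amounts to vanishing on the ideal, tested on one
    relator at a time. *)
Definition word_functional L : Prop :=
  [/\ forall p e h q, L (p ++ [:: inl e; inr h] ++ q) = L (p ++ [:: inr h; inl e] ++ q),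
      forall p l q, L (p ++ [:: l; l] ++ q) = L (p ++ [:: l] ++ q),
      forall p x a a' q, a != a' -> L (p ++ [:: inl (x, a); inl (x, a')] ++ q) = 0 &
      forall p y b b' q, b != b' -> L (p ++ [:: inr (y, b); inr (y, b')] ++ q) = 0].

(* The functional is only given on the words of O^2; an equivalence class of words
   modulo the ideal that misses O^2 is sent to 0. *)
Lemma extend_functional L :
  (forall f, in_ideal f -> (forall w, coef f w != 0 -> in_O2 Ob w) -> evalL L f = 0) ->
  exists2 L', word_functional L' & forall w, in_O2 Ob w -> L' w = L w.
Proof.
move=> ker.
have kerE w1 w2 : in_O2 Ob w1 -> in_O2 Ob w2 -> weq w1 w2 -> L w1 = L w2.
  move=> O1 O2 /ker; rewrite /evalL !big_cons big_nil /= => H.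
  suff : 1 * L w1 + (-1 * L w2 + 0) = 0 by lra.
  apply: H => w; rewrite coef_pair.
  case: (w1 =P w) => [<- //|_]; case: (w2 =P w) => [<- //|_].
  by rewrite !mulr0 addr0 eqxx.
have kerZ w : in_O2 Ob w -> in_ideal ([:: (1, w)] : fsum R X A Y B) -> L w = 0.
  move=> Ow /ker; rewrite /evalL big_seq1 mul1r; apply.
  by move=> w'; rewrite coef1; case: (w =P w') => [<- //|_]; rewrite mulr0 eqxx.
(* The value is taken at a chosen representative in [O^2]; [kerE] makes it independent of the
   choice. *)
pose L' w := if pselect (exists w', in_O2 Ob w' /\ weq w w') is left h
             then L (sval (cid h)) else 0.
have L'E w1 w2 : weq w1 w2 -> L' w1 = L' w2.
  move=> e12; rewrite /L'.
  case: pselect => h1; case: pselect => h2 //.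
  - case: (cid h1) (cid h2) => w1' [O1 e1] [w2' [O2 e2]] /=; apply: kerE => //.
    by apply: weq_trans (weq_sym e1) (weq_trans e12 e2).
  - by case: h2; have [w [Ow ew]] := h1; exists w; split=> //; apply: weq_trans (weq_sym e12) ew.
  - by case: h1; have [w [Ow ew]] := h2; exists w; split=> //; apply: weq_trans e12 ew.
have L'Z w : in_ideal ([:: (1, w)] : fsum R X A Y B) -> L' w = 0.
  move=> z; rewrite /L'; case: pselect => // h; case: (cid h) => w' [Ow' e] /=.
  by apply: kerZ => //; apply: weq_zero e z.
exists L'; last first.
  move=> w Ow; rewrite /L'; case: pselect => [h|[]]; last by exists w; split=> //; apply: weq_refl.
  by case: (cid h) => w' [Ow' e] /=; apply: kerE => //; apply: weq_sym.
have rel (r : fsum R X A Y B) p q :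
    is_relator r -> in_ideal [seq (d.1, p ++ d.2 ++ q) | d <- r].
  move=> /(in_ideal_relator p q 1); congr in_ideal.
  by apply: eq_map => d; rewrite mul1r.
split=> [p e h q|p l q|p x a a' q ne|p y b b' q ne].
- apply: L'E; apply: (rel [:: (1, [:: inl e; inr h]); (-1, [:: inr h; inl e])] p q).
  by left; exists e, h.
- apply: L'E; apply: (rel [:: (1, [:: l; l]); (-1, [:: l])] p q).
  by right; left; exists l.
- apply: L'Z; apply: (rel [:: (1, [:: inl (x, a); inl (x, a')])] p q).
  by right; right; left; exists x, a, a'.
- apply: L'Z; apply: (rel [:: (1, [:: inr (y, b); inr (y, b')])] p q).
  by right; right; right; exists y, b, b'.
Qed.

Lemma word_functional_swap L p (u : seq (X * A)) (v : seq (Y * B)) q :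
  word_functional L ->
  L (p ++ map inr v ++ map inl u ++ q) = L (p ++ map inl u ++ map inr v ++ q).
Proof.
move=> [comm _ _ _].
have one p' h q' : L (p' ++ inr h :: map inl u ++ q') = L (p' ++ map inl u ++ inr h :: q').
  elim: u p' => //= e u IHu p'.
  by rewrite -(comm p' e h (_ ++ _)) /= -(cat_rcons (inl e)) IHu cat_rcons.
elim: v p => //= h v IHv p.
by rewrite -one -!cat_rcons IHv.
Qed.

(** Modulo the ideal, a word equals its Alice letters followed by its Bob letters; [lefts] and
    [rights] extract the two parts. *)
Definition lefts (w : word X A Y B) : seq (X * A) :=
  pmap (fun l => if l is inl e then Some e else None) w.
Definition rights (w : word X A Y B) : seq (Y * B) :=
  pmap (fun l => if l is inr h then Some h else None) w.

Lemma lefts_word (u : seq (X * A)) (v : seq (Y * B)) : lefts (map inl u ++ map inr v) = u.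
Proof.
rewrite /lefts pmap_cat (_ : pmap _ (map inr v) = [::]) ?cats0; first by elim: u => //= e u ->.
by elim: v.
Qed.

Lemma rights_word (u : seq (X * A)) (v : seq (Y * B)) : rights (map inl u ++ map inr v) = v.
Proof.
rewrite /rights pmap_cat (_ : pmap _ (map inl u) = [::]); last by elim: u.
by rewrite /=; elim: v => //= e v ->.
Qed.

Lemma pmap_rev (S T : Type) (g : S -> option T) s : pmap g (rev s) = rev (pmap g s).
Proof.
elim: s => //= x s IHs; rewrite rev_cons -cats1 pmap_cat IHs /=.
by case: (g x) => [y|] /=; rewrite ?cats0 ?rev_cons -?cats1.
Qed.

Lemma in_OP w : in_O Ob w <->
  exists2 t : seq (X * A) * seq (Y * B), sizes_in Ob t & w = map inl t.1 ++ map inr t.2.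
Proof.
split=> [[m [n [Omn [u [v [su sv ->]]]]]]|[[u v] [m [n [Omn su sv]]] ->]].
  by exists (u, v) => //; exists m, n.
by exists m, n; split=> //; exists u, v.
Qed.

(** The extended functional is read on words with Alice's letters first, then averaged with its
    reversal; reversal fixes words of length one, so the box is still reproduced. *)
Lemma moment_of_functional (P : X -> Y -> A -> B -> R) : O_positive Ob P ->
  exists2 M, moment_functional Ob M & forall x y a b, P x y a b = M [:: (x, a)] [:: (y, b)].
Proof.
move=> [_ [L0 [ker L1 pos LP]]]; have [L wfL LE] := extend_functional ker.
have wfS := word_functional_swap _ _ _ _ wfL.
case: (wfL) => _ idem orthA orthB.
pose N (u : seq (X * A)) (v : seq (Y * B)) : R := L (map inl u ++ map inr v).
have NA v : projective (N^~ v).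
  split=> [u l u'|u x a a' u' ne]; rewrite /N !map_cat -!catA; first exact: idem.
  exact: orthA.
have NB u : projective (N u).
  have E v1 v2 : map inl u ++ map inr (v1 ++ v2) =
      (map inl u ++ map inr v1) ++ map inr v2 :> word X A Y B by rewrite map_cat catA.
  split=> [v l v'|v y b b' v' ne]; rewrite /N !E !map_cat; first exact: idem.
  exact: orthB.
have O0 : in_O Ob ([::] : word X A Y B) by apply/in_OP; exists ([::], [::]) => //; exists 1%N, 0%N.
have O1 x a : in_O Ob ([:: inl (x, a)] : word X A Y B).
  by apply/in_OP; exists ([:: (x, a)], [::]) => //; exists 1%N, 0%N.
have O2 y b : in_O Ob ([:: inr (y, b)] : word X A Y B).
  by apply/in_OP; exists ([::], [:: (y, b)]) => //; exists 0%N, 1%N.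
exists (fun u v => (N u v + N (rev u) (rev v)) / 2); last first.
  move=> x y a b; rewrite LP /N /= -mulr2n -[_ *+ 2]mulr_natr mulfK ?pnatr_eq0 // LE //.
  by exists [:: inl (x, a)], [:: inr (y, b)].
split.
- move=> v; have [i1 o1] := NA v; have [i2 o2] := NA (rev v).
  split=> [u l u'|u x a a' u' ne]; first by rewrite !rev_cat -!catA i1 i2.
  by rewrite !rev_cat -!catA o1 // o2 1?eq_sym // addr0 mul0r.
- move=> u; have [i1 o1] := NB u; have [i2 o2] := NB (rev u).
  split=> [v l v'|v y b b' v' ne]; first by rewrite !rev_cat -!catA i1 i2.
  by rewrite !rev_cat -!catA o1 // o2 1?eq_sym // addr0 mul0r.
- by move=> u v; rewrite !revK addrC.
- rewrite /N /= LE ?L1; first by lra.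
  by exists [::], [::].
apply/psd_onP => f Df.
pose Q := \sum_(s <- f) \sum_(t <- f) s.1 * t.1 * moment_kernel N s.2 t.2.
have Qge0 : 0 <= Q.
  pose wd (t : seq (X * A) * seq (Y * B)) : word X A Y B := map inl t.1 ++ map inr t.2.
  have := pos [seq (t.1, wd t.2) | t <- f].
  rewrite big_map => /(_ _)/le_trans -> //.
    by move=> _ /mapP[t /Df Dt ->]; apply/in_OP; exists t.2.
  rewrite le_eqVlt; apply/orP; left; apply/eqP; rewrite /Q big_seq [RHS]big_seq.
  apply: eq_bigr => s sf; rewrite big_map big_seq [RHS]big_seq; apply: eq_bigr => t tf /=.
  congr (_ * _); rewrite -LE; last first.
    by exists (wd s.2), (wd t.2); split=> //; apply/in_OP; [exists s.2|exists t.2] => //; apply: Df.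
  (* In this product all Bob letters precede Alice's letters of the second factor; commutation
     restores the normal form. *)
  rewrite /moment_kernel /N /conjw /wd rev_cat -!map_rev !map_cat -!catA.
  have := wfS (map inl s.2.1) (rev t.2.1) (s.2.2 ++ rev t.2.2) [::].
  by rewrite !map_cat !cats0 -!catA.
suff -> : \sum_(s <- f) \sum_(t <- f) s.1 * t.1 *
    moment_kernel (fun u v => (N u v + N (rev u) (rev v)) / 2) s.2 t.2 = Q by [].
(* Reversal turns [moment_kernel N] into its transpose, which has the same quadratic form, so
   averaging leaves the form unchanged. *)
have Q2 : Q = \sum_(s <- f) \sum_(t <- f) s.1 * t.1 * moment_kernel N t.2 s.2.
  by rewrite /Q exchange_big; apply: eq_bigr => s _; apply: eq_bigr => t _; rewrite [t.1 * _]mulrC.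
have -> : Q = (Q + Q) / 2 by lra.
rewrite {2}Q2 /Q -big_split mulr_suml; apply: eq_bigr => s _.
rewrite -big_split mulr_suml; apply: eq_bigr => t _ /=.
by rewrite /moment_kernel !rev_cat !revK; ring.
Qed.

(** The functional sorts a word by [lefts] and [rights]: commutators vanish at once, and the other
    relators reduce to the relations of one party. *)
Lemma functional_of_moment (P : X -> Y -> A -> B -> R) M : is_box P ->
  moment_functional Ob M -> (forall x y a b, P x y a b = M [:: (x, a)] [:: (y, b)]) ->
  O_positive Ob P.
Proof.
move=> boxP [MA MB symM M1 posM] PM; split=> //.
pose L w := M (lefts w) (rights w).
have lcat w w' : lefts (w ++ w') = lefts w ++ lefts w' by rewrite /lefts pmap_cat.
have rcat w w' : rights (w ++ w') = rights w ++ rights w' by rewrite /rights pmap_cat.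
exists L; split=> //.
  move=> f [ts [rel /(eq_evalL L) ->]] _.
  rewrite /evalL /ideal_sum big_flatten big_map big_seq big1 // => -[[[c p] r] q] /rel /=.
  move=> relr; rewrite big_map; case: relr.
    move=> [e [h ->]]; rewrite !big_cons big_nil /= /L !lcat !rcat /=; ring.
  case=> [[l ->]|[[x [a [a' [ne ->]]]]|[y [b [b' [ne ->]]]]]];
    rewrite !big_cons big_nil /= /L !lcat !rcat /=.
  - case: l => l /=.
      by have [-> _] := MA (rights p ++ rights q); ring.
    by have [-> _] := MB (lefts p ++ lefts q); ring.
  - by have [_ ->] := MA (rights p ++ rights q); rewrite // mulr0 addr0.
  - by have [_ ->] := MB (lefts p ++ lefts q); rewrite // mulr0 addr0.
move=> f Of; have /psd_onP := posM => /(_ [seq (t.1, (lefts t.2, rights t.2)) | t <- f]).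
rewrite big_map => /(_ _)/le_trans -> //.
  move=> _ /mapP[t /Of /in_OP[[u v] D E] ->] /=.
  by rewrite E lefts_word rights_word.
rewrite le_eqVlt; apply/orP; left; apply/eqP; apply: eq_bigr => s _.
rewrite big_map; apply: eq_bigr => t _ /=.
by rewrite /moment_kernel /L lcat rcat /conjw /lefts /rights !pmap_rev.
Qed.

End Box.
End MomentTheory.

(** * Wirings as sums over the leaves of the decision trees *)

(** The inner sums are rewritten over the tagged union of the [T j], where distributivity applies;
    [dffun_of_fprod] turns the selections back into dependent functions. *)
Lemma sum_dffun_prod (R : comPzSemiRingType) (J : finType) (T : J -> finType)
    (F : forall j, T j -> R) :
  \sum_(a : {dffun forall j, T j}) \prod_j F j (a j) = \prod_j \sum_(x : T j) F j x.
Proof.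
pose F' j : {ffun T j -> R} := [ffun x => F j x].
transitivity (\prod_j \sum_(x : T j) F' j x); last first.
  by apply: eq_bigr => j _; apply: eq_bigr => x _; rewrite ffunE.
under [RHS]eq_bigr do rewrite (big_tag (fun j x => F' j x)).
rewrite bigA_distr_big_dep -big_fprod.
rewrite (reindex (@dffun_of_fprod _ T)); last exact/onW_bij/dffun_of_fprod_bij.
by apply: eq_bigr => a _; apply: eq_bigr => j _; rewrite !ffunE.
Qed.

Section Leaves.
Variables (R : realType) (K : nat) (I O : 'I_K -> finType).

Local Notation path := (forall k, seq (I k * O k)).

Definition nil_path : path := fun=> [::].

(** A path keeps one word per box and forgets the order between boxes, whose projectors sit in
    different tensor factors. *)
Fixpoint leaves (Out : Type) (t : strat I O Out) (s : path) : seq (Out * path) :=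
  match t with
  | Leaf r => [:: (r, s)]
  | Probe k i c => flatten [seq leaves (c o) (dfwith s [:: (i, o)]) | o <- index_enum (O k)]
  end.

Section Out.
Variable Out : eqType.
Implicit Types (t : strat I O Out) (s : path).

Lemma big_leaves_probe k i (c : O k -> strat I O Out) s (F : Out * path -> R) :
  \sum_(p <- leaves (Probe i c) s) F p =
  \sum_o \sum_(p <- leaves (c o) (dfwith s [:: (i, o)])) F p.
Proof. by rewrite /= big_flatten big_map. Qed.

Lemma leaves_probeP k i (c : O k -> strat I O Out) s p :
  p \in leaves (Probe i c) s -> exists o, p \in leaves (c o) (dfwith s [:: (i, o)]).
Proof. by move=> /= /flattenP[_ /mapP[o _ ->] po]; exists o. Qed.

Lemma leaves_used t used s p k : once_from t used -> k \in used ->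
  p \in leaves t s -> p.2 k = s k.
Proof.
elim: t used s => [r|k' i c IHc] used s.
  by move=> _ _; rewrite inE => /eqP->.
move=> [k'u onc] ku /leaves_probeP[o /(IHc o _ _ (onc o)) ->].
  by rewrite dfwith_out //; apply: contraNneq k'u => ->.
by rewrite inE ku orbT.
Qed.

Lemma size_leaves t s p k : (size (s k) <= 1)%N -> p \in leaves t s -> (size (p.2 k) <= 1)%N.
Proof.
elim: t s => [r|k' i c IHc] s sz; first by rewrite inE => /eqP->.
move=> /leaves_probeP[o]; apply: IHc.
by have [<-|ne] := eqVneq k' k; rewrite ?dfwith_in ?dfwith_out.
Qed.

Definition orth_path (s s' : path) : Prop :=
  exists k x a a', [/\ a != a', s k = [:: (x, a)] & s' k = [:: (x, a')]].

(** Two distinct leaves separate at a node, with different outputs of one measurement; as that box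
    is not probed again, both letters remain in the final paths and make them orthogonal. *)
Lemma sum_leaves_orth t used s (G : Out * path -> Out * path -> R) : once_from t used ->
  (forall p q, orth_path p.2 q.2 -> G p q = 0) ->
  \sum_(p <- leaves t s) \sum_(q <- leaves t s) G p q = \sum_(p <- leaves t s) G p p.
Proof.
move=> onc G0; elim: t used s onc => [r|k i c IHc] used s /=.
  by rewrite !big_seq1.
move=> [_ onc]; rewrite !big_leaves_probe; apply: eq_bigr => o _.
rewrite -(IHc o _ _ (onc o)) big_seq [RHS]big_seq; apply: eq_bigr => p po.
rewrite big_leaves_probe (bigD1 o) //= [X in _ + X]big1 ?addr0 // => o' ne.
rewrite big_seq big1 // => q qo'; apply: G0; exists k, i, o, o'.
rewrite eq_sym ne (leaves_used (onc o) _ po) ?(leaves_used (onc o') _ qo') ?inE ?eqxx //.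
by rewrite !dfwith_in.
Qed.

(** The subtrees collapse by induction, and completeness of the measurement at the root removes its
    letter. *)
Lemma sum_leaves_complete t used s (m : forall k, seq (I k * O k) -> R) :
  once_from t used -> (forall k, k \notin used -> s k = [::]) ->
  (forall k i, \sum_o m k [:: (i, o)] = m k [::]) ->
  \sum_(p <- leaves t s) \prod_k m k (p.2 k) = \prod_k m k (s k).
Proof.
move=> onc s0 mE; elim: t used s onc s0 => [r|k i c IHc] used s /=.
  by rewrite big_seq1.
move=> [ku onc] s0; rewrite big_leaves_probe.
transitivity (\sum_o \prod_j m j (dfwith s [:: (i, o)] j)).
  apply: eq_bigr => o _; apply: IHc (onc o) _ => j; rewrite inE negb_or => /andP[jk ju].
  by rewrite dfwith_out 1?eq_sym ?s0.
rewrite [RHS](bigD1 k) //= s0 // -(mE k i) mulr_suml; apply: eq_bigr => o _.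
rewrite (bigD1 k) //= dfwith_in; congr (_ * _); apply: eq_bigr => j jk.
by rewrite dfwith_out 1?eq_sym.
Qed.

Lemma input_used t used (a : forall k, O k) k : once_from t used -> k \in used ->
  input t a k = None.
Proof.
elim: t used => [//|k' i c IHc] used /= [k'u onc] ku.
case: eqP => [e|_]; first by rewrite e ku in k'u.
by apply: IHc (onc _) _; rewrite inE ku orbT.
Qed.

Lemma input_probe k (i : I k) (c : O k -> strat I O Out) (a : forall k, O k) :
  input (Probe i c) a k = Some i.
Proof. by rewrite /=; case: eqP => // e; rewrite eq_axiomK. Qed.

Lemma input_probe_neq k k' (i : I k) (c : O k -> strat I O Out) (a : forall k, O k) :
  k != k' -> input (Probe i c) a k' = input (c (a k)) a k'.
Proof. by rewrite /=; case: eqP. Qed.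

(* Summing over all joint outputs of the boxes collapses to a sum over leaves: the
   unprobed boxes, with weights N, are summed out.  Probing box k is absorbed in N by
   making it a point mass at the observed output. *)
Lemma sum_assignments t used s (F : Out -> R) (S : forall k, I k -> O k -> R)
    (N : forall k, O k -> R) (W : forall k, seq (I k * O k) -> R) :
  once_from t used ->
  (forall k x o, W k [:: (x, o)] = S k x o) ->
  (forall k, W k (s k) = \sum_o N k o) ->
  \sum_(a : {dffun forall k, O k}) F (result t a) *
     \prod_k (if input t a k is Some x then S k x (a k) else N k (a k)) =
  \sum_(p <- leaves t s) F p.1 * \prod_k W k (p.2 k).
Proof.
move=> onc WS; elim: t used s N onc => [r|k i c IHc] used s N onc WN.
  rewrite big_seq1 /= -mulr_sumr sum_dffun_prod; congr (_ * _).
  by apply: eq_bigr => k _; rewrite WN.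
case: onc => ku onc; rewrite big_leaves_probe.
pose N' o := dfwith N (fun a : O k => if a == o then S k i o else 0).
transitivity (\sum_o \sum_(a : {dffun forall k, O k}) F (result (c o) a) *
     \prod_j (if input (c o) a j is Some x then S j x (a j) else N' o j (a j))).
  rewrite [RHS]exchange_big; apply: eq_bigr => a _.
  rewrite [RHS](bigD1 (a k)) // [X in _ = _ + X]big1 ?addr0; last first.
    move=> o ne; rewrite (bigD1 k) //= (input_used _ (onc o)) ?inE ?eqxx //.
    by rewrite /N' dfwith_in eq_sym (negbTE ne) mul0r mulr0.
  congr (_ * _); apply: eq_bigr => j _; have [<-|kj] := eqVneq k j.
    by rewrite input_probe (input_used _ (onc _)) ?inE ?eqxx // /N' dfwith_in eqxx.
  by rewrite input_probe_neq // /N' dfwith_out.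
apply: eq_bigr => o _; apply: IHc (onc o) _ => j.
have [<-|kj] := eqVneq k j; last by rewrite /N' !dfwith_out.
by rewrite /N' !dfwith_in WS (bigD1 o) //= eqxx big1 ?addr0 // => o' /negbTE->.
Qed.

End Out.

(** * Products of effective projectors *)

Section Expand.
Variables (X' A' : finType) (T : X' -> strat I O A').

Definition cat_path (s s' : path) : path := fun k => s k ++ s' k.
Definition rev_path (s : path) : path := fun k => rev (s k).

Lemma cat_pathA s1 s2 s3 : cat_path s1 (cat_path s2 s3) = cat_path (cat_path s1 s2) s3.
Proof. by apply: functional_extensionality_dep => k; rewrite /cat_path catA. Qed.

Lemma cat_path0 s : cat_path s nil_path = s.
Proof. by apply: functional_extensionality_dep => k; rewrite /cat_path cats0. Qed.

Definition paths (l : X' * A') : seq path :=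
  [seq p.2 | p <- leaves (T l.1) nil_path & p.1 == l.2].

(* The summands of the effective projector of each letter are the tensor products of
   projectors along its leaves; expand multiplies these sums out. *)
Fixpoint expand (u : seq (X' * A')) : seq path :=
  if u is l :: u' then [seq cat_path p s | p <- paths l, s <- expand u'] else [:: nil_path].

Lemma big_paths l (G : path -> R) :
  \sum_(s <- paths l) G s = \sum_(p <- leaves (T l.1) nil_path | p.1 == l.2) G p.2.
Proof. by rewrite /paths big_map big_filter. Qed.

Lemma big_expand_cons l u (G : path -> R) :
  \sum_(s <- expand (l :: u)) G s = \sum_(p <- paths l) \sum_(s <- expand u) G (cat_path p s).
Proof. by rewrite /= big_flatten big_map; apply: eq_bigr => p _; rewrite big_map. Qed.

Lemma big_expand1 l (G : path -> R) : \sum_(s <- expand [:: l]) G s = \sum_(s <- paths l) G s.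
Proof.
by rewrite big_expand_cons; apply: eq_bigr => p _; rewrite /= big_seq1 cat_path0.
Qed.

Lemma big_expand_cat u v (G : path -> R) :
  \sum_(s <- expand (u ++ v)) G s =
  \sum_(s <- expand u) \sum_(s' <- expand v) G (cat_path s s').
Proof.
elim: u G => [|l u IHu] G; first by rewrite /= big_seq1.
rewrite cat_cons !big_expand_cons; apply: eq_bigr => p _; rewrite IHu.
by apply: eq_bigr => s _; apply: eq_bigr => s' _; rewrite cat_pathA.
Qed.

Lemma size_paths l s k : s \in paths l -> (size (s k) <= 1)%N.
Proof. by move=> /mapP[p]; rewrite mem_filter => /andP[_ /(size_leaves (k := k))] + ->; apply. Qed.

(** This bound keeps the expansion of an element of [O] inside [O] for every box, with the same [m]
    and [n]. *)
Lemma size_expand u s k : s \in expand u -> (size (s k) <= size u)%N.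
Proof.
elim: u s => [|l u IHu] s /=; first by rewrite inE => /eqP->.
move=> /allpairsP[[p s'] /= [/(size_paths k) sp /IHu ss ->]].
by rewrite size_cat -add1n leq_add.
Qed.

(** Conjugation reverses the order of the factors and fixes each of them, since a path of one letter
    meets each box at most once. *)
Lemma big_expand_rev u (G : path -> R) :
  \sum_(s <- expand (rev u)) G s = \sum_(s <- expand u) G (rev_path s).
Proof.
elim: u G => [|l u IHu] G; first by rewrite /= !big_seq1.
rewrite rev_cons -cats1 big_expand_cat IHu big_expand_cons.
under eq_bigr do rewrite big_expand1.
rewrite exchange_big /= big_seq [RHS]big_seq; apply: eq_bigr => p pl.
apply: eq_bigr => s _; congr G; apply: functional_extensionality_dep => k.
rewrite /cat_path /rev_path rev_cat; congr (_ ++ _).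
by have := size_paths k pl; case: (p k) => [|x [|]].
Qed.

Hypothesis onceT : forall x, once (T x).

(** For two adjacent letters with the same input, orthogonality of distinct leaves leaves only the
    diagonal terms. With different outputs there are none; with equal outputs idempotence in each
    box merges the two copies. *)
Lemma projective_expand (m : forall k, seq (I k * O k) -> R) :
  (forall k, projective (m k)) ->
  projective (fun u => \sum_(s <- expand u) \prod_k m k (s k)).
Proof.
move=> mP.
pose H (s p q s' : path) := \prod_k m k (s k ++ p k ++ q k ++ s' k).
have two u x a a' v : \sum_(s <- expand (u ++ [:: (x, a); (x, a')] ++ v)) \prod_k m k (s k) =
    \sum_(s <- expand u) \sum_(s' <- expand v)
      \sum_(p <- leaves (T x) nil_path | (p.1 == a) && (p.1 == a')) H s p.2 p.2 s'.
  rewrite big_expand_cat; apply: eq_bigr => s _.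
  rewrite big_expand_cat exchange_big; apply: eq_bigr => s' _.
  rewrite big_expand_cons big_paths.
  under eq_bigr do rewrite big_expand1 big_paths.
  pose G p q := if (p.1 == a) && (q.1 == a') then H s p.2 q.2 s' else 0.
  transitivity (\sum_(p <- leaves (T x) nil_path) \sum_(q <- leaves (T x) nil_path) G p q).
    rewrite big_mkcond; apply: eq_bigr => p _ /=; rewrite /G.
    case: (p.1 == a); last by rewrite big1.
    rewrite big_mkcond; apply: eq_bigr => q _; case: (q.1 == a') => //.
    by apply: eq_bigr => k _; rewrite /cat_path -catA.
  rewrite (sum_leaves_orth _ (onceT x)) -?big_mkcond //.
  move=> p q [k [i [o [o' [ne pk qk]]]]]; rewrite /G; case: ifP => // _.
  have [_ orth] := mP k.
  by rewrite /H (bigD1 k) //= pk qk -[X in s k ++ X]/([:: (i, o); (i, o')] ++ s' k) orth // mul0r.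
split=> [u [x a] v|u x a a' v ne]; last first.
  rewrite two big1 // => s _; rewrite big1 // => s' _; rewrite big1 // => p /andP[/eqP->].
  by rewrite (negbTE ne).
rewrite two [RHS]big_expand_cat; apply: eq_bigr => s _.
rewrite [RHS]big_expand_cat [RHS]big_expand1 [RHS]exchange_big; apply: eq_bigr => s' _.
rewrite big_paths /= big_seq_cond [RHS]big_seq_cond.
apply: eq_big => [p|p /andP[pl _]]; first by rewrite andbb.
apply: eq_bigr => k _; have [idem _] := mP k.
have := @size_leaves _ (T x) nil_path p k isT pl.
by rewrite /cat_path; case: (p.2 k) => [|l [|]] //= _; apply: idem.
Qed.
End Expand.

End Leaves.

Lemma sum_paths (R : realType) (K : nat) (I O : 'I_K -> finType) (X' A' : finType)
    (T : X' -> strat I O A') x (G : (forall k, seq (I k * O k)) -> R) :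
  \sum_a \sum_(s <- paths T (x, a)) G s = \sum_(p <- leaves (T x) (@nil_path K I O)) G p.2.
Proof.
under eq_bigr do rewrite big_paths big_mkcond /=.
rewrite exchange_big; apply: eq_bigr => p _.
by rewrite -big_mkcond (big_pred1 p.1) // => a; rewrite eq_sym.
Qed.

Lemma projective_sum (R : realType) (I O : eqType) (T : Type) (r : seq T)
    (F : T -> seq (I * O) -> R) :
  (forall t, projective (F t)) -> projective (fun u => \sum_(t <- r) F t u).
Proof.
move=> FP; split=> [u l v|u x a a' v ne].
  by apply: eq_bigr => t _; have [-> _] := FP t.
by rewrite big1 // => t _; have [_ ->] := FP t.
Qed.

(** * The moment functional of a wiring *)

Section Wired.
Variables (R : realType) (Ob : nat -> nat -> Prop).
Hypotheses (Ob10 : Ob 1%N 0%N) (Ob01 : Ob 0%N 1%N).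
Variables (K : nat) (X A Y B : 'I_K -> finType).
Variable P : forall k, X k -> Y k -> A k -> B k -> R.
Arguments P : clear implicits.
Hypothesis boxP : forall k, is_box (P k).
Variable M : forall k, seq (X k * A k) -> seq (Y k * B k) -> R.
Arguments M : clear implicits.
Hypothesis momM : forall k, moment_functional Ob (M k).
Hypothesis PM : forall k x y a b, P k x y a b = M k [:: (x, a)] [:: (y, b)].
Variables (X' A' Y' B' : finType).
Variables (TA : X' -> strat X A A') (TB : Y' -> strat Y B B').
Hypotheses (onceA : forall x, once (TA x)) (onceB : forall y, once (TB y)).

Lemma box_norm k x y : \sum_a \sum_b M k [:: (x, a)] [:: (y, b)] = 1.
Proof.
have [_ [norm _ _]] := boxP k; rewrite -(norm x y).
by apply: eq_bigr => a _; apply: eq_bigr => b _; rewrite PM.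
Qed.

Lemma box_completeA k x v : (size v <= 1)%N -> \sum_a M k [:: (x, a)] v = M k [::] v.
Proof.
(* When [v] is empty, normalisation is still applied at some input [y0] of Bob. *)
have [[_ /card_gt0P[y0 _] _] _] := boxP k.
case: v => [|[y b] [|]] // _.
  by apply: (sum_outcomesA Ob10 Ob01 (momM k) (box_norm x y0)); left.
by apply: (sum_outcomesA Ob10 Ob01 (momM k) (box_norm x y)); right; exists b.
Qed.

Lemma box_completeB k y u : (size u <= 1)%N -> \sum_b M k u [:: (y, b)] = M k u [::].
Proof.
have [[/card_gt0P[x0 _] _ _] _] := boxP k.
case: u => [|[x a] [|]] // _.
  by apply: (sum_outcomesB Ob10 Ob01 (momM k) (box_norm x0 y)); left.
by apply: (sum_outcomesB Ob10 Ob01 (momM k) (box_norm x y)); right; exists a.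
Qed.

(** The tensor product of the functionals [M k], evaluated at the expansions of the two effective
    words. *)
Definition wired_moment (u : seq (X' * A')) (v : seq (Y' * B')) : R :=
  \sum_(s <- expand TA u) \sum_(t <- expand TB v) \prod_k M k (s k) (t k).

Lemma wired_moment_nil : wired_moment [::] [::] = 1.
Proof. by rewrite /wired_moment /= !big_seq1 big1 // => k _; case: (momM k). Qed.

Lemma wired_moment_kernel p q : moment_kernel wired_moment p q =
  \sum_(s <- expand TA p.1) \sum_(t <- expand TB p.2)
    \sum_(s' <- expand TA q.1) \sum_(t' <- expand TB q.2)
      \prod_k moment_kernel (M k) (s k, t k) (s' k, t' k).
Proof.
rewrite /moment_kernel /wired_moment big_expand_cat; apply: eq_bigr => s _.
under eq_bigr do rewrite big_expand_cat.
rewrite exchange_big; apply: eq_bigr => t _.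
rewrite big_expand_rev; apply: eq_bigr => s' _.
by rewrite big_expand_rev; apply: eq_bigr => t' _.
Qed.

(** The form at [f] is the form of the product kernel [G] at the expanded family [f'], in which
    every path inherits the coefficient of its word. [G] is positive by the Schur product
    theorem. *)
Lemma wired_moment_psd : psd_on (@sizes_in Ob _ _) (moment_kernel wired_moment).
Proof.
pose pathA := forall k, seq (X k * A k); pose pathB := forall k, seq (Y k * B k).
pose G (p q : pathA * pathB) :=
  \prod_k moment_kernel (M k) (p.1 k, p.2 k) (q.1 k, q.2 k).
have psdG : psd_on (fun p : pathA * pathB => forall k, sizes_in Ob (p.1 k, p.2 k)) G.
  move=> I e De; apply: psd_prod => [k i j|k]; have [_ _ sym _ pM] := momM k.
    exact: moment_kernel_sym.
  exact: (pM I (fun i => ((e i).1 k, (e i).2 k)) (De^~ k)).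
apply/psd_onP => f Df.
pose ex (t : R * (seq (X' * A') * seq (Y' * B'))) :=
  [seq (t.1, (s, s')) | s <- expand TA t.2.1, s' <- expand TB t.2.2].
pose f' := flatten [seq ex t | t <- f].
have big_f' (F : R * (pathA * pathB) -> R) : \sum_(z <- f') F z =
    \sum_(t <- f) \sum_(s <- expand TA t.2.1) \sum_(s' <- expand TB t.2.2) F (t.1, (s, s')).
  rewrite /f' big_flatten big_map; apply: eq_bigr => t _.
  by rewrite /ex big_flatten big_map; apply: eq_bigr => s _; rewrite big_map.
have /psd_onP/(_ f') := psdG; rewrite big_f' => /(_ _)/le_trans -> //.
  move=> _ /flattenP[_ /mapP[t tf ->] /allpairsP[[s s'] /= [sA sB ->]]] k /=.
  have [m [n [Omn sm sn]]] := Df _ tf; exists m, n; split=> //=.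
    exact: leq_trans (size_expand k sA) sm.
  exact: leq_trans (size_expand k sB) sn.
rewrite le_eqVlt; apply/orP; left; apply/eqP; apply: eq_bigr => z _.
transitivity (\sum_(s <- expand TA z.2.1) \sum_(t <- f) \sum_(s' <- expand TB z.2.2)
    \sum_(q <- expand TA t.2.1) \sum_(q' <- expand TB t.2.2) z.1 * t.1 * G (s, s') (q, q')).
  apply: eq_bigr => s _; rewrite [RHS]exchange_big; apply: eq_bigr => s' _.
  by rewrite big_f'.
rewrite exchange_big; apply: eq_bigr => t _; rewrite wired_moment_kernel mulr_sumr.
apply: eq_bigr => s _; rewrite mulr_sumr; apply: eq_bigr => s' _.
rewrite mulr_sumr; apply: eq_bigr => q _; rewrite mulr_sumr; exact: eq_bigr.
Qed.

Lemma wired_moment_functional : moment_functional Ob wired_moment.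
Proof.
split; last exact: wired_moment_psd.
- move=> v; rewrite (_ : wired_moment^~ v = fun u => \sum_(t <- expand TB v)
      \sum_(s <- expand TA u) \prod_k M k (s k) (t k)); last first.
    by apply/funext => u; rewrite /wired_moment exchange_big.
  apply: projective_sum => t; apply: (projective_expand onceA (m := fun k => (M k)^~ (t k))).
  by move=> k; have [pA _ _ _ _] := momM k.
- move=> u; apply: projective_sum => s; apply: (projective_expand onceB (m := fun k => M k (s k))) => k.
  by have [_ pB _ _ _] := momM k.
- move=> u v; rewrite /wired_moment big_expand_rev; apply: eq_bigr => s _.
  rewrite big_expand_rev; apply: eq_bigr => t _; apply: eq_bigr => k _.
  by have [_ _ sym _ _] := momM k; apply: sym.
- exact: wired_moment_nil.
Qed.

(** * Completeness of the effective measurements, and agreement with the wired box *)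

Lemma wired_completeA x v : (size v <= 1)%N ->
  \sum_a wired_moment [:: (x, a)] v = wired_moment [::] v.
Proof.
move=> sv; rewrite /wired_moment; under eq_bigr do rewrite big_expand1.
rewrite sum_paths exchange_big /= big_seq1 big_seq [RHS]big_seq; apply: eq_bigr => t tv.
apply: (sum_leaves_complete (m := fun k => (M k)^~ (t k)) (onceA x)) => // k i.
exact: box_completeA (leq_trans (size_expand k tv) sv).
Qed.

Lemma wired_completeB y u : (size u <= 1)%N ->
  \sum_b wired_moment u [:: (y, b)] = wired_moment u [::].
Proof.
move=> su; rewrite /wired_moment exchange_big big_seq [RHS]big_seq; apply: eq_bigr => s sv.
under eq_bigr do rewrite big_expand1.
rewrite sum_paths /= big_seq1.
apply: (sum_leaves_complete (m := fun k => M k (s k)) (onceB y)) => // k i.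
exact: box_completeB (leq_trans (size_expand k sv) su).
Qed.

(** [weight] and [joint] are the box weights in terms of path words: an empty word means that the
    party does not probe the box, and its output is summed out. *)
Let weight k (ox : option (X k)) (v : seq (Y k * B k)) (a : A k) : R :=
  if v is (y, b) :: _ then box_weight P ox (Some y) a b
  else \sum_b box_weight P ox None a b.

Let joint k (u : seq (X k * A k)) (v : seq (Y k * B k)) : R :=
  if u is (x, a) :: _ then weight (Some x) v a else \sum_a weight None v a.

Lemma card_outcomes_neq0 k : #|A k|%:R != 0 :> R /\ #|B k|%:R != 0 :> R.
Proof.
have [[/card_gt0P[x _] /card_gt0P[y _] _] [norm _ _]] := boxP k.
rewrite !pnatr_eq0; split; apply/negP => /eqP/card0_eq z; have := norm x y.
  rewrite big1 => [/eqP|a]; first by rewrite eq_sym oner_eq0.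
  by have := z a.
rewrite big1 => [/eqP|a _]; first by rewrite eq_sym oner_eq0.
by rewrite big1 // => b; have := z b.
Qed.

Lemma margAE k x a : margA (P k) x a = M k [:: (x, a)] [::].
Proof.
have [[_ Y0 _] _] := boxP k; rewrite /margA.
under eq_bigr => y _.
  under eq_bigr do rewrite PM.
  rewrite box_completeB //; over.
by rewrite sumr_const -[M _ _ _ *+ _]mulr_natl mulKf // pnatr_eq0 -lt0n.
Qed.

Lemma margBE k y b : margB (P k) y b = M k [::] [:: (y, b)].
Proof.
have [[X0 _ _] _] := boxP k; rewrite /margB.
under eq_bigr => x _.
  under eq_bigr do rewrite PM.
  rewrite box_completeA //; over.
by rewrite sumr_const -[M _ _ _ *+ _]mulr_natl mulKf // pnatr_eq0 -lt0n.
Qed.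

(** Summing over an unprobed output cancels its uniform weight, which leaves the marginal, or [1]
    when neither party probes the box. *)
Lemma jointE k u v : (size u <= 1)%N -> (size v <= 1)%N -> joint u v = M k u v.
Proof.
have [A0 B0] := card_outcomes_neq0 k.
case: u => [|[x a] [|]] //; case: v => [|[y b] [|]] // _ _; rewrite /joint /weight /=.
- have [_ _ _ -> _] := momM k.
  by rewrite !sumr_const -mulrnA -[_^-1 *+ _]mulr_natl natrM [X in X / _]mulrC mulfV // mulf_neq0.
- by rewrite sumr_const -[_ / _ *+ _]mulr_natl mulrC divfK // margBE.
- by rewrite sumr_const -[_ / _ *+ _]mulr_natl mulrC divfK // margAE.
- by rewrite PM.
Qed.

(** [sum_assignments] is applied first to Bob's tree with Alice's outputs fixed, then to Alice's
    tree with Bob's leaf fixed; [jointE] identifies the remaining factors. *)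
Lemma wiredE x y a b : wired P TA TB x y a b = wired_moment [:: (x, a)] [:: (y, b)].
Proof.
pose FA r : R := (r == a)%:R; pose FB r : R := (r == b)%:R.
transitivity (\sum_(oa : {dffun forall k, A k}) FA (result (TA x) oa) *
    \sum_(q <- leaves (TB y) (@nil_path K Y B)) FB q.1 *
      \prod_k weight (input (TA x) oa k) (q.2 k) (oa k)).
  apply: eq_bigr => oa _.
  rewrite -(@sum_assignments _ _ _ _ _ (TB y) [::] (@nil_path K Y B) FB
     (fun k y b => box_weight P (input (TA x) oa k) (Some y) (oa k) b)
     (fun k b => box_weight P (input (TA x) oa k) None (oa k) b)
     (fun k v => weight (input (TA x) oa k) v (oa k))) //; last exact: onceB.
  rewrite mulr_sumr; apply: eq_bigr => ob _; rewrite /FA /FB.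
  case: (_ == a); case: (_ == b); rewrite /= ?mul0r ?mul1r //.
  by apply: eq_bigr => k _; case: (input (TB y) ob k).
under eq_bigr do rewrite mulr_sumr.
rewrite exchange_big /wired_moment big_expand1.
under [RHS]eq_bigr do rewrite big_expand1.
rewrite [RHS]exchange_big big_paths [RHS]big_mkcond /= big_seq [RHS]big_seq; apply: eq_bigr => q qy.
rewrite big_paths [X in if _ then X else _]big_mkcond /=.
transitivity (FB q.1 * \sum_(p <- leaves (TA x) (@nil_path K X A)) FA p.1 *
    \prod_k joint (p.2 k) (q.2 k)).
  rewrite -(@sum_assignments _ _ _ _ _ (TA x) [::] (@nil_path K X A) FA
     (fun k x a => weight (Some x) (q.2 k) a)
     (fun k a => weight None (q.2 k) a) (fun k u => joint u (q.2 k))) //; last exact: onceA.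
  rewrite mulr_sumr; apply: eq_bigr => oa _; rewrite mulrCA; congr (_ * (_ * _)).
  by apply: eq_bigr => k _; case: (input (TA x) oa k).
rewrite /FB; case: (q.1 == b); rewrite ?mul0r // mul1r big_seq [RHS]big_seq.
apply: eq_bigr => p px; rewrite /FA; case: (p.1 == a); rewrite ?mul0r // mul1r.
by apply: eq_bigr => k _; apply: jointE; [apply: size_leaves px | apply: size_leaves qy].
Qed.

Lemma box_weight_ge0 k ox oy a b : 0 <= box_weight P (k := k) ox oy a b.
Proof.
have [[_ _ P0] _] := boxP k.
case: ox oy => [x|] [y|] //=; rewrite ?invr_ge0 ?mulr_ge0 ?invr_ge0 //.
  by apply: sumr_ge0 => y _; apply: sumr_ge0.
by apply: sumr_ge0 => x _; apply: sumr_ge0.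
Qed.

(** For normalisation and no-signalling, summing over the outputs of one party replaces its letter
    by the empty word, whatever the input. *)
Lemma wired_box : (0 < #|X'|)%N -> (0 < #|Y'|)%N -> is_box (wired P TA TB).
Proof.
move=> X0 Y0; split; split=> //.
- move=> x y a b; apply: sumr_ge0 => oa _; apply: sumr_ge0 => ob _; case: ifP => // _.
  by apply: prodr_ge0 => k _; apply: box_weight_ge0.
- move=> x y; under eq_bigr do under eq_bigr do rewrite wiredE.
  under eq_bigr do rewrite wired_completeB //.
  by rewrite wired_completeA // wired_moment_nil.
- move=> x y y' a; under eq_bigr do rewrite wiredE.
  under [RHS]eq_bigr do rewrite wiredE.
  by rewrite !wired_completeB.
- move=> x x' y b; under eq_bigr do rewrite wiredE.
  under [RHS]eq_bigr do rewrite wiredE.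
  by rewrite !wired_completeA.
Qed.

End Wired.

Theorem theorem4 (R : realType) (Ob : nat -> nat -> Prop) :
  Ob 1%N 0%N -> Ob 0%N 1%N ->
  closed_under_wirings (fun X A Y B : finType => @O_positive R X A Y B Ob).
Proof.
move=> Ob10 Ob01 K X A Y B P OP X' A' Y' B' X0 Y0 TA TB onceA onceB.
have boxP k : is_box (P k) by case: (OP k).
pose Mex k := cid2 (moment_of_functional Ob10 Ob01 (OP k)).
pose M k := s2val (Mex k).
have momM k : moment_functional Ob (M k) := s2valP (Mex k).
have PM k := s2valP' (Mex k).
apply: (functional_of_moment (M := wired_moment M TA TB)).
- exact: (wired_box Ob10 Ob01 boxP momM PM onceA onceB X0 Y0).
- exact: wired_moment_functional.
- exact: (wiredE Ob10 Ob01 boxP momM PM onceA onceB).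
Qed.
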